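(* Let $X_1,\dots,X_n$ be independent random vectors, $G=(V,E)$ a graph on $V=\{1,\dots,n\}$, $\{h_e\}_{e\in E}$ a collection of bivariate kernels, and $U=\sum_{e=(i,j)\in E}h_e(X_i,X_j)$. Let $N=|E|$ and let $d_{\max}$ be the maximum node degree of $G$. Suppose that for every $e=(i,j)\in E$ there exists $\sigma_e>0$ such that $$\mathbb{E}\Bigl[e^{\lambda\{h_e(X_i,X_j)-\mathbb{E}h_e(X_i,X_j)\}}\Bigr]\le e^{\lambda^2\sigma_e^2/2}\qquad\text{for all }\lambda>0,$$ and let $\sigma^2=N^{-1}\sum_{e\in E}\sigma_e^2$. Then, for all $t>0$, $$\mathbb{P}\left(\frac{U-\mathbb{E}U}{N}>t\right)\le\exp\left\{-\frac{Nt^2}{2(d_{\max}+1)\sigma^2}\right\}.$$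
   Context: The random vectors $X_1,\dots,X_n\in\mathbb{R}^p$ are independent but not necessarily identically distributed. $G=(V,E)$ is an arbitrary deterministic simple undirected graph with at least one edge; each edge $e\in E$ is written as a pair $e=(i,j)$ in one fixed order of its endpoints. For each $e\in E$, $h_e:\mathbb{R}^p\times\mathbb{R}^p\to\mathbb{R}$ is a measurable function (kernel), which may depend on $e$ and need not be symmetric; the expectations $\mathbb{E}h_e(X_i,X_j)$ are finite. *)

(* Defs.v *)
From mathcomp Require Export all_boot all_order all_algebra.
From mathcomp Require Export all_classical all_reals all_analysis.
Export Order.TTheory GRing.Theory Num.Theory numFieldNormedType.Exports.
Set Implicit Arguments.
Unset Strict Implicit.
Unset Printing Implicit Defensive.
Local Open Scope classical_set_scope.
Local Open Scope ring_scope.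

(* R^p: tuples carry the product of p copies of the Borel sigma-algebra of R,
   which is the Borel sigma-algebra of R^p. *)
Notation euclidean R p := (p.-tuple (R : realType)).

(* Joint (not merely pairwise) independence; the X i share a codomain but may
   have different laws. *)
Definition mutually_independent d d' (Omega : measurableType d)
    (S : measurableType d') (R : realType) (P : probability Omega R)
    (I : finType) (X : I -> {RV P >-> S}) : Prop :=
  forall (J : {set I}) (A : I -> set S),
    (forall i, i \in J -> measurable (A i)) ->
    P (\bigcap_(i in [set` J]) X i @^-1` A i) =
    (\prod_(i in J) P (X i @^-1` A i))%E.

(* An edge is an unordered pair of distinct vertices, so loops and multiple
   edges are excluded. *)
Record sgraph (V : finType) := SGraph {
  edges : {set {set V}};
  card_edge : forall e, e \in edges -> #|e| = 2%N }.

Definition degree (V : finType) (G : sgraph V) (v : V) : nat :=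
  #|[set e in edges G | v \in e]%SET|.

Definition max_degree (V : finType) (G : sgraph V) : nat :=
  \max_(v : V) degree G v.

(* [o] fixes, for each edge e, an order (i, j) of its two endpoints. *)
Definition endpoint_order (V : finType) (G : sgraph V)
    (o : {set V} -> V * V) : Prop :=
  forall e, e \in edges G -> e = [set (o e).1; (o e).2]%SET.

Definition kernel_at d (Omega : measurableType d) (R : realType) (p : nat)
    (P : probability Omega R) (V : finType) (X : V -> {RV P >-> euclidean R p})
    (o : {set V} -> V * V) (h : {set V} -> euclidean R p * euclidean R p -> R)
    (e : {set V}) : Omega -> R :=
  fun w => h e (X (o e).1 w, X (o e).2 w).

Definition graph_sum d (Omega : measurableType d) (R : realType) (p : nat)
    (P : probability Omega R) (V : finType) (X : V -> {RV P >-> euclidean R p})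
    (G : sgraph V) (o : {set V} -> V * V)
    (h : {set V} -> euclidean R p * euclidean R p -> R) : Omega -> R :=
  fun w => \sum_(e in edges G) kernel_at X o h e w.

(* Main.v *)
From HB Require Import structures.
Require Import Defs.
From mathcomp Require Import perm measurable_realfun.
From mathcomp Require Import ring.
Set Implicit Arguments.
Unset Strict Implicit.
Unset Printing Implicit Defensive.
Local Open Scope classical_set_scope.
Local Open Scope ring_scope.

(** The edges of a matching involve disjoint pairs of independent vectors, so
    the exponential moment of a sum of centred kernels over a matching is the
    product of the individual ones, and such a sum is sub-Gaussian with
    variance proxy the sum of the [sigma e ^+ 2] ([integral_prod_pairs],
    [exponential_moment_disjoint_pairs]).

    By Vizing's theorem ([vizing]) the edge set splits into
    [D = max_degree G + 1] matchings, so [U - E U] is a sum of [D] sub-Gaussian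
    variables of unknown joint law, with variance proxies [v k] that add up to
    the sum [T] of all [sigma e ^+ 2].  Convexity of the exponential, with
    weights proportional to [sqrt (v k)], shows that the total is sub-Gaussian
    with proxy the square of the sum of the [sqrt (v k)]
    ([subgaussian_sum]), and this is at most [D * T] by the Cauchy-Schwarz
    inequality ([sqr_sum_le]).  Chernoff's bound ([subgaussian_tail]) at level
    [t * N] gives the exponent [- (t * N) ^+ 2 / (2 * D * T)], which is the
    claimed one since [T = N * sigma2].

    The constant [D] rests on Vizing's theorem; a greedy edge colouring would
    only give [2 * max_degree G - 1] matchings.  It is proved here by fans and
    Kempe changes.  A colour class is encoded as the involution that exchanges
    the two ends of each of its edges and fixes the other vertices, so that a
    colour is missing at a vertex when its involution fixes that vertex, and
    the two-coloured chain through a vertex is an orbit of a pair of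
    involutions. *)

(** * Orbits of two involutions *)

Section InvolutionOrbits.
Local Open Scope nat_scope.
Variables (V : finType) (a b : V -> V).
Hypotheses (invol_a : involutive a) (invol_b : involutive b).
Variable x : V.
Hypothesis ax : a x = x.

Let g := a \o b.

Let inj_g : injective g.
Proof. exact: inj_comp (inv_inj invol_a) (inv_inj invol_b). Qed.

(** Conjugation by [a] inverts [g], and [a] fixes [x]. *)
Let g_a_iter i : iter i g (a (iter i g x)) = x.
Proof.
have gag v : g (a (g v)) = a v by rewrite /g /= invol_a invol_b.
by elim: i => [|i IHi]; rewrite ?ax // iterSr iterS gag.
Qed.

(** As [a] fixes [x], the cycle of [x] under [a \o b] is already stable under
    each of the two involutions: it is the whole Kempe chain of [x]. *)
Lemma fconnect_involl v : fconnect (a \o b) x v -> fconnect (a \o b) x (a v).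
Proof.
move=> /iter_findex <-; have sym_g := fconnect_sym inj_g.
have := fconnect_iter g (findex g x v) (a (iter (findex g x v) g x)).
by rewrite g_a_iter sym_g.
Qed.

Lemma fconnect_involr v : fconnect (a \o b) x v -> fconnect (a \o b) x (b v).
Proof.
move=> xv; rewrite -[b v]invol_a; apply: fconnect_involl.
exact: connect_trans xv (fconnect1 _ _).
Qed.

(** A two-coloured chain has at most two ends. If [b] fixes [g^i x], where
    [g = a \o b], then [g^(2i+1) x = x]. For two such exponents [i <= j] this
    makes the cycle length of [x] odd and a divisor of [2 (j - i)], hence a
    divisor of [j - i]. *)
Lemma invol_orbit_end_unique y z :
  fconnect (a \o b) x y -> fconnect (a \o b) x z -> b y = y -> b z = z -> y = z.
Proof.
move=> /iter_findex <- /iter_findex <-.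
move: (findex _ _ _) (findex _ _ _) => i j.
have period k : b (iter k g x) = iter k g x -> iter (k.*2.+1) g x = x.
  move=> bk; rewrite -addnn -addnS iterD iterS.
  by rewrite (_ : g _ = a (iter k g x)) ?g_a_iter // -[in RHS]bk.
wlog le_ij : i j / i <= j.
  by move=> th; case: (leqP i j) => [/th|/ltnW /th h] // bi bj; rewrite h.
move=> /period pj /period pi.
have mulP k m : iter k g x = x -> iter (m * k) g x = x.
  by move=> pk; elim: m => [//|m IHm]; rewrite mulSn iterD IHm pk.
have p2 : iter (j - i).*2 g x = x.
  by rewrite -[RHS]pj -[in RHS](subnK le_ij) doubleD -addnS iterD pi.
have p1 : iter (j - i) g x = x.
  have := mulP _ (j - i) pi; rewrite mulnS iterD.
  by rewrite -doubleMr mulnC doubleMr (mulP _ i p2).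
by rewrite -(subnKC le_ij) iterD p1.
Qed.

End InvolutionOrbits.

(** The relation is cut at the vertices of [A], so the path obtained meets [A]
    only at its end. *)
Lemma connect_first (T : finType) (e : rel T) (A : pred T) x t :
  connect e x t -> A t ->
  exists2 t', A t' & connect [rel u v | e u v && ~~ A u] x t'.
Proof.
move=> /connectP[s].
elim: s x => [|y s IHs] x /=; first by move=> _ -> At; exists x.
move=> /andP[exy es] t_last At; case: (boolP (A x)) => Ax; first by exists x.
have [t' At' yt'] := IHs y es t_last At; exists t' => //.
by apply: connect_trans yt'; apply: connect1; rewrite /= exy.
Qed.

(** * Vizing's theorem *)

Section Vizing.
Local Open Scope nat_scope.
Variables (V C : finType) (E : rel V).
Hypotheses (E_irr : irreflexive E) (E_sym : symmetric E).

(** A partial proper colouring of the edges of [E], given by its colour classes: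
    [f c x] is the other end of the edge of colour [c] at [x], or [x] itself if
    [c] is missing at [x]. *)
Definition edge_coloring (f : C -> V -> V) :=
  [/\ forall c, involutive (f c),
      forall c x, f c x != x -> E x (f c x) &
      forall c c' x, f c x = f c' x -> f c x != x -> c = c'].

Definition colored (f : C -> V -> V) x y := [exists c, f c x == y].

Lemma colored_sym f x y : edge_coloring f -> colored f x y = colored f y x.
Proof.
move=> [fK _ _].
by apply/existsP/existsP => -[c /eqP <-]; exists c; rewrite fK.
Qed.

(** Gives the colour [c0] to the edge between [x] and [y], and takes it away
    from the edge that has this colour at [x], if there is one. *)
Definition recolor (f : C -> V -> V) c0 x y : C -> V -> V := fun c u =>
  if c != c0 then f c u else
  if u == x then y else if u == y then x else if u == f c0 x then u else f c u.

Section Recolor.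
Variables (f : C -> V -> V) (c0 : C) (x y : V).
Hypotheses (fP : edge_coloring f) (Exy : E x y) (xyN : ~~ colored f x y).
Hypothesis c0y : f c0 y = y.

Lemma recolor_coloring : edge_coloring (recolor f c0 x y).
Proof.
have [fK fE f1] := fP.
have xy : x != y by apply: contraTneq Exy => ->; rewrite E_irr.
have fxy c : f c x != y.
  by apply: contraNneq xyN => <-; apply/existsP; exists c.
have fyx c : f c y != x by rewrite -(inj_eq (inv_inj (fK c))) fK eq_sym.
split=> [c u|c u|].
- rewrite /recolor; case: (eqVneq c c0) => [->|_] /=; last exact: fK.
  case: (eqVneq u x) => [->|ux]; first by rewrite eq_sym (negbTE xy) eqxx.
  case: (eqVneq u y) => [->|uy]; first by rewrite eqxx.
  case: (eqVneq u (f c0 x)) => [ufx|ufx].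
    by rewrite (negbTE ux) (negbTE uy) ufx eqxx.
  have /negbTE -> : f c0 u != x by rewrite -(inj_eq (inv_inj (fK c0))) fK.
  have /negbTE -> : f c0 u != y.
    by rewrite -(inj_eq (inv_inj (fK c0))) fK c0y.
  by rewrite (inj_eq (inv_inj (fK c0))) (negbTE ux) fK.
- rewrite /recolor; case: (eqVneq c c0) => [->|_] /=; last exact: fE.
  case: (eqVneq u x) => [-> //|ux].
  case: (eqVneq u y) => [->|uy]; first by rewrite E_sym.
  by case: (eqVneq u (f c0 x)) => [->|_]; [rewrite eqxx|exact: fE].
- have key c u : c != c0 -> recolor f c0 x y c0 u = f c u ->
      f c u != u -> False.
    rewrite /recolor eqxx /= => cc0.
    case: (eqVneq u x) => [-> /eqP|ux].
      by rewrite eq_sym (negbTE (fxy c)).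
    case: (eqVneq u y) => [-> /eqP|uy].
      by rewrite eq_sym (negbTE (fyx c)).
    case: (eqVneq u (f c0 x)) => [_ <-|_]; first by rewrite eqxx.
    by move=> e nu; move: cc0; rewrite (f1 c c0 u) ?eqxx.
  move=> c c' u; case: (eqVneq c c0) => [->|cc0];
    case: (eqVneq c' c0) => [-> //|cc'].
  + rewrite {2}/recolor cc' => e; rewrite e => nu; by case: (key _ _ cc' e nu).
  + rewrite {1 3}/recolor cc0 => e nu; by case: (key _ _ cc0 (esym e) nu).
  + rewrite /recolor cc0 cc'; exact: f1.
Qed.

Lemma recolor_colored : colored (recolor f c0 x y) x y.
Proof. by apply/existsP; exists c0; rewrite /recolor !eqxx. Qed.

Lemma recolor_mono u v : u != v -> colored f u v ->
  [|| colored (recolor f c0 x y) u v, (u == x) && (v == f c0 x)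
    | (v == x) && (u == f c0 x)].
Proof.
have [fK fE f1] := fP.
move=> uv /existsP[c /eqP fcu].
case: (eqVneq c c0) => [cc0|cc0]; last first.
  by apply/orP; left; apply/existsP; exists c; rewrite /recolor cc0 fcu.
rewrite -{}fcu {}cc0 in uv *.
case: (eqVneq u x) => [->|ux]; first by rewrite eqxx orbT.
rewrite andFb orFb -[X in _ && (X == _)](fK c0).
rewrite (inj_eq (inv_inj (fK c0))) andbb.
case: (eqVneq (f c0 u) x) => [_|fux]; first by rewrite orbT.
rewrite orbF; apply/existsP; exists c0; rewrite /recolor eqxx /= (negbTE ux).
case: (eqVneq u y) => [uy|_]; first by rewrite uy c0y eqxx in uv.
case: (eqVneq u (f c0 x)) => [ufx|//].
by rewrite ufx fK eqxx in fux.
Qed.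

End Recolor.

(** A path of this relation is a fan around [x]: each edge from [x] to a vertex
    of the path, except the first, has a colour that is missing at the vertex
    before. *)
Definition fan_step (f : C -> V -> V) x : rel V := fun y z =>
  [exists c, [&& f c y == y, f c x == z & z != x]].

(** Each colour of the fan moves one step back, which frees the last edge of the
    fan for the colour [c]. Shifting one edge at a time leaves the rest of the
    fan intact, because its vertices, hence its colours, are distinct. *)
Lemma fan_shift f c x y s :
  edge_coloring f -> E x y -> ~~ colored f x y ->
  path (fan_step f x) y s -> uniq (y :: s) -> f c x = x ->
  f c (last y s) = last y s ->
  exists f', [/\ edge_coloring f', colored f' x y &
    forall u v, u != v -> colored f u v -> colored f' u v].
Proof.
move=> + + + + + + +; elim: s f y => [|z s IHs] f y fP Exy xyN.
  move=> _ _ cx cy; exists (recolor f c x y); split.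
  - exact: recolor_coloring.
  - exact: recolor_colored.
  - move=> u v uv /(recolor_mono x fP cy uv).
    by case/or3P=> [//| |] /andP[/eqP uE /eqP vE]; rewrite uE vE cx eqxx in uv.
rewrite [path _ _ _]/= => /andP[/existsP[c0 /and3P[/eqP c0y /eqP c0x zx]] zs].
move=> yzs cx clast.
have [fK fE f1] := fP.
have gP := recolor_coloring fP Exy xyN c0y.
have gxy := recolor_colored f c0 x y.
have gmono := recolor_mono x fP c0y.
have yx : y != x by apply: contraTneq Exy => ->; rewrite E_irr.
have cc0 : c != c0 by apply: contraNneq zx => cE; rewrite -c0x -cE cx.
have zy : z != y.
  by apply: contraNneq xyN => <-; apply/existsP; exists c0; rewrite c0x.
have [||||||f' [f'P f'xz f'mono]] := IHs (recolor f c0 x y) z gP.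
- by rewrite -c0x fE // c0x.
- apply/existsP => -[c1]; rewrite /recolor.
  case: (eqVneq c1 c0) => [_|c10] /=; first by rewrite eqxx eq_sym (negbTE zy).
  rewrite -c0x => /eqP e; move: c10.
  by rewrite (f1 c1 c0 x e) ?eqxx // e c0x.
- apply/(pathP x) => i i_s.
  have /existsP[c1 /and3P[c1y c1x wx]] := pathP x zs i i_s.
  apply/existsP; exists c1; rewrite /recolor.
  suff -> : c1 != c0 by apply/and3P.
  apply: contraTneq yzs => c1E; rewrite -c0x -c1E (eqP c1x) /=.
  by rewrite mem_nth // andbF.
- by move: yzs => /= /andP[].
- by rewrite /recolor cc0.
- by rewrite /recolor cc0.
exists f'; split=> //.
  by apply: f'mono gxy; rewrite eq_sym.
move=> u v uv /(gmono _ _ uv) /or3P[/(f'mono _ _ uv) //| |].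
  by move=> /andP[/eqP -> /eqP ->]; rewrite c0x.
by move=> /andP[/eqP -> /eqP ->]; rewrite c0x colored_sym.
Qed.

Lemma fan_shift_connect f c x y t :
  edge_coloring f -> E x y -> ~~ colored f x y ->
  connect (fan_step f x) y t -> f c x = x -> f c t = t ->
  exists f', [/\ edge_coloring f', colored f' x y &
    forall u v, u != v -> colored f u v -> colored f' u v].
Proof.
move=> fP Exy xyN /connectP[s ys ->] cx.
case/shortenP: ys => s' ys' us' _ clast; exact: fan_shift ys' us' cx clast.
Qed.

(** Exchanges the colours [c1] and [c2] outside [W]. *)
Definition kempe_swap (f : C -> V -> V) (W : pred V) c1 c2 : C -> V -> V :=
  fun c u => f (if W u then c else tperm c1 c2 c) u.

Section KempeSwap.
Variables (f : C -> V -> V) (W : pred V) (c1 c2 : C).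
Hypotheses (fP : edge_coloring f).
Hypothesis W1 : forall u, W u -> W (f c1 u).
Hypothesis W2 : forall u, W u -> W (f c2 u).

Lemma kempe_swap_coloring : edge_coloring (kempe_swap f W c1 c2).
Proof.
have [fK fE f1] := fP.
have W1E u : W (f c1 u) = W u.
  by apply/idP/idP => [/W1|/W1 //]; rewrite fK.
have W2E u : W (f c2 u) = W u.
  by apply/idP/idP => [/W2|/W2 //]; rewrite fK.
split=> [c u|c u|c c' u].
- rewrite /kempe_swap.
  case: tpermP => [->|->|_ _].
  + by case Wu: (W u); rewrite ?W1E ?W2E Wu fK.
  + by case Wu: (W u); rewrite ?W1E ?W2E Wu fK.
  + by rewrite !if_same fK.
- exact: fE.
- rewrite /kempe_swap; case: (W u) => [|e nu]; first exact: f1.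
  exact: perm_inj (f1 _ _ _ e nu).
Qed.

Lemma kempe_swap_colored u v :
  colored f u v -> colored (kempe_swap f W c1 c2) u v.
Proof.
move=> /existsP[c cu]; apply/existsP.
exists (if W u then c else tperm c1 c2 c).
by rewrite /kempe_swap; case: (W u) cu => //; rewrite tpermK.
Qed.

End KempeSwap.

Hypothesis degC : forall x, #|[pred y | E x y]| < #|C|.

(** Otherwise the colours would inject into the neighbours of [x]. *)
Lemma missing_color f x : edge_coloring f -> exists c, f c x = x.
Proof.
move=> [fK fE f1].
have [/existsP[c /eqP cx]|] := boolP [exists c, f c x == x]; first by exists c.
rewrite negb_exists => /forallP nx; have := degC x.
rewrite ltnNge => /negP[].
have inj : injective (f^~ x) by move=> c c' e; exact: f1 e (nx c).
rewrite -(card_codom inj); apply: subset_leq_card; apply/fintype.subsetP => y.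
by move=> /codomP[c ->]; rewrite inE; exact: fE.
Qed.

(** Choose a missing colour [m z] at each vertex [z]. If some vertex that a fan
    from [y] reaches misses a colour that is also missing at [x], shift the fan.
    Otherwise [z |-> f (m z) x] maps the set of reached vertices into itself
    minus [y], hence two of them miss the same colour [c2]. With [c1] missing at
    [x], the [c1]-[c2] chain of [x] cannot end at both of them, so some reached
    vertex outside this chain misses [c2]. Swapping [c1] and [c2] outside the
    chain leaves the fan valid up to the first such vertex, where [c1] is now
    missing, as it is at [x]. *)
Lemma extend_coloring f x y : edge_coloring f -> E x y -> ~~ colored f x y ->
  exists f', [/\ edge_coloring f', colored f' x y &
    forall u v, u != v -> colored f u v -> colored f' u v].
Proof.
move=> fP Exy xyN; have [fK fE f1] := fP.
have yx : y != x by apply: contraTneq Exy => ->; rewrite E_irr.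
have /fin_all_exists[m mP] v : exists c, f c v = v by exact: missing_color.
pose S := [set z | connect (fan_step f x) y z]%SET.
have yS : y \in S by rewrite inE.
have [/existsP[z /andP[zS /existsP[c /andP[/eqP cz /eqP cx]]]]|] :=
    boolP [exists z in S, exists c, (f c z == z) && (f c x == x)].
  by rewrite inE in zS; exact: fan_shift_connect zS cx cz.
rewrite negb_exists => /forallP noend.
have mx z : z \in S -> f (m z) x != x.
  move=> zS; have := noend z; rewrite zS /= negb_exists => /forallP/(_ (m z)).
  by rewrite mP eqxx.
have [z1 [z2 [z1S z2S z12 m12]]] :
    exists z1 z2, [/\ z1 \in S, z2 \in S, z1 != z2 & m z1 = m z2].
  have : ~~ [forall z1 in S, forall z2 in S, (m z1 == m z2) ==> (z1 == z2)].
    apply/negP => /forall_inP inj_m.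
    have inj_next : {in S &, injective (fun z => f (m z) x)}.
      move=> z1 z2 z1S z2S e; apply/eqP.
      have /forall_inP/(_ _ z2S)/implyP := inj_m _ z1S; apply.
      by apply/eqP; exact: f1 e (mx _ z1S).
    have: [set f (m z) x | z in S]%SET \subset (S :\ y)%SET.
      apply/fintype.subsetP => _ /imsetP[z zS ->].
      rewrite !inE; apply/andP; split.
        by apply: contraNneq xyN => <-; apply/existsP; exists (m z).
      move: (zS); rewrite inE => /connect_trans; apply; apply: connect1.
      by apply/existsP; exists (m z); rewrite mP !eqxx mx.
    move=> /subset_leq_card; rewrite card_in_imset //.
    by rewrite [in X in X <= _](cardsD1 y) yS ltnn.
  rewrite negb_forall => /existsP[z1]; rewrite negb_imply => /andP[z1S].
  rewrite negb_forall => /existsP[z2]; rewrite negb_imply => /andP[z2S].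
  by rewrite negb_imply => /andP[/eqP m12 z12]; exists z1, z2; split.
pose c1 := m x; pose c2 := m z1; have c1x : f c1 x = x := mP x.
pose W := fconnect (f c1 \o f c2) x.
pose T z := (f c2 z == z) && ~~ W z.
have [t tS Tt] : exists2 t, t \in S & T t.
  have [Wz1|Wz1] := boolP (W z1); last by exists z1 => //; rewrite /T mP eqxx.
  have [Wz2|Wz2] := boolP (W z2).
    case/eqP: z12.
    apply: (invol_orbit_end_unique (fK c1) (fK c2) c1x Wz1 Wz2 (mP z1)).
    by rewrite /c2 m12.
  by exists z2 => //; rewrite /T Wz2 /c2 m12 mP eqxx.
rewrite inE in tS.
have [{Tt tS}t Tt yt] := connect_first tS Tt.
have W1 u : W u -> W (f c1 u) by exact: fconnect_involl.
have W2 u : W u -> W (f c2 u) by exact: fconnect_involr.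
have gP := kempe_swap_coloring fP W1 W2.
have gE := @kempe_swap_colored f W c1 c2.
have Wx : W x by exact: connect0.
have gx c : kempe_swap f W c1 c2 c x = f c x by rewrite /kempe_swap Wx.
have [//| ||||g [gP' gxy gmono]] :=
  @fan_shift_connect (kempe_swap f W c1 c2) c1 x y t gP.
- apply: contra xyN => /existsP[c]; rewrite gx => cx.
  by apply/existsP; exists c.
- apply: connect_sub yt => u v /andP[/existsP[c /and3P[/eqP cu cx vx]] uT].
  apply: connect1; apply/existsP; exists c; rewrite gx cx vx !andbT /kempe_swap.
  case Wu: (W u); first by rewrite cu.
  case: tpermP => [cE|cE|_ _]; last by rewrite cu.
    by move: vx; rewrite -(eqP cx) cE c1x eqxx.
  (* a step of colour c2 from outside the chain would start in T *)
  by move: uT; rewrite /= /T -cE cu eqxx Wu.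
- by rewrite gx.
- by case/andP: Tt => /eqP Tt /negbTE Wt; rewrite /kempe_swap Wt tpermL.
- by exists g; split=> // u v uv /gE; exact: gmono.
Qed.

Lemma vizing_coloring :
  exists2 f, edge_coloring f & forall x y, E x y -> colored f x y.
Proof.
pose todo f := [set q : V * V | E q.1 q.2 && ~~ colored f q.1 q.2]%SET.
suff complete k : forall f, edge_coloring f -> #|todo f| < k ->
    exists2 f, edge_coloring f & forall x y, E x y -> colored f x y.
  apply: (complete _ (fun=> id)) (ltnSn _).
  by split=> // [c x|c c' x _]; rewrite eqxx.
elim: k => // k IHk f fP todo_k.
have [/existsP[[x y] /andP[/= Exy xyN]]|] :=
    boolP [exists q : V * V, E q.1 q.2 && ~~ colored f q.1 q.2]; last first.
  rewrite negb_exists => /forallP done; exists f => // x y Exy.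
  by have := done (x, y); rewrite /= Exy negbK.
have [g [gP gxy gmono]] := extend_coloring fP Exy xyN.
apply: (IHk g gP); rewrite -ltnS; apply: leq_trans todo_k; rewrite ltnS.
apply: proper_card; apply/properP; split; last first.
  by exists (x, y); rewrite !inE /= Exy ?xyN ?gxy.
apply/fintype.subsetP => -[u v]; rewrite !inE /= => /andP[Euv uvN].
rewrite Euv; apply: contra uvN; apply: gmono.
by apply: contraTneq Euv => ->; rewrite E_irr.
Qed.

End Vizing.

Section VizingGraph.
Variables (V : finType) (G : sgraph V).

Definition adjacent : rel V := fun x y =>
  (x != y) && ([set x; y]%SET \in edges G).

Lemma card_adjacent x : (#|[pred y | adjacent x y]| <= max_degree G)%N.
Proof.
apply: leq_trans (leq_bigmax x).
rewrite -(card_in_imset (f := fun y => [set x; y]%SET)); last first.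
  move=> y z; rewrite !inE => /andP[xy _] /andP[xz _] yz.
  have : y \in [set x; z]%SET by rewrite -yz set22.
  by rewrite !inE eq_sym (negbTE xy) => /eqP.
apply: subset_leq_card; apply/fintype.subsetP => _ /imsetP[y + ->].
by rewrite !inE => /andP[_ ->]; rewrite eqxx.
Qed.

Lemma vizing : exists chi : {set V} -> 'I_(max_degree G).+1,
  forall e e' u, e \in edges G -> e' \in edges G -> chi e = chi e' ->
  u \in e -> u \in e' -> e = e'.
Proof.
have irr : irreflexive adjacent by move=> x; rewrite /adjacent eqxx.
have sym : symmetric adjacent.
  by move=> x y; rewrite /adjacent eq_sym finset.setUC.
have deg x : (#|[pred y | adjacent x y]| < #|'I_(max_degree G).+1|)%N.
  by rewrite card_ord ltnS card_adjacent.
have [f [fK _ _] fE] := vizing_coloring irr sym deg.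
(* the colour of e determines e from any one of its ends *)
have /fin_all_exists[chi chiP] (e : {set V}) : exists c,
    e \in edges G -> forall u, u \in e -> e = [set u; f c u]%SET.
  have [eG|eN] := boolP (e \in edges G); last by exists ord0.
  have /cards2P[x [y [xy eE]]] : #|e| == 2 by rewrite (card_edge eG).
  have /fE/existsP[c /eqP fcx] : adjacent x y by rewrite /adjacent xy -eE.
  exists c => _ u; rewrite eE !inE => /orP[] /eqP ->; first by rewrite fcx.
  have -> : f c y = x by rewrite -fcx fK.
  exact: finset.setUC.
exists chi => e e' u eG eG' chiE ue ue'.
by rewrite (chiP e eG u ue) (chiP e' eG' u ue') chiE.
Qed.

End VizingGraph.

(** * The law of a random element under a density *)

Section WeightedLaw.
Local Open Scope ereal_scope.
Context d d' (T : measurableType d) (T' : measurableType d') (R : realType).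
Variable mu : {measure set T -> \bar R}.
Variables (H : T -> R) (Y : T -> T').

(** The image under [Y] of the measure of density [H] with respect to [mu]. The
    hypotheses are arguments so that the measure structure can be attached to
    this constant. *)
Definition weighted_law of measurable_fun setT H & (forall x, 0 <= H x)%R &
    measurable_fun setT Y : set T' -> \bar R :=
  fun B => \int[mu]_(x in Y @^-1` B) (H x)%:E.

Hypothesis mH : measurable_fun setT H.
Hypothesis H0 : forall x, (0 <= H x)%R.
Hypothesis mY : measurable_fun setT Y.

Local Notation nu := (weighted_law mH H0 mY).

Let nu0 : nu set0 = 0.
Proof. by rewrite /weighted_law preimage_set0 integral_set0. Qed.

Let nu_ge0 B : 0 <= nu B.
Proof. by apply: integral_ge0 => x _; rewrite lee_fin. Qed.

Let measurable_preimY B : measurable B -> measurable (Y @^-1` B).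
Proof. by move=> mB; rewrite -[_ @^-1` _]setTI; exact: mY. Qed.

Let nu_sigma_additive : semi_sigma_additive nu.
Proof.
move=> F mF tF mUF; rewrite /weighted_law preimage_bigcup.
rewrite ge0_integral_bigcup //=.
- apply: is_cvg_nneseries => n _ _.
  by apply: integral_ge0 => x _; rewrite lee_fin.
- by move=> k; exact: measurable_preimY.
- exact/measurable_funTS/measurable_EFinP.
- by move=> x _; rewrite lee_fin.
- move/trivIsetP : tF => tF; apply/trivIsetP => /= i j _ _ ij.
  by rewrite -preimage_setI tF // preimage_set0.
Qed.

HB.instance Definition _ := isMeasure.Build _ _ _ nu
  nu0 nu_ge0 nu_sigma_additive.

Import HBNNSimple.

(** Immediate for simple functions, then by monotone convergence. *)
Lemma integral_weighted_law (f : T' -> R) : measurable_fun setT f ->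
  (forall y, 0 <= f y)%R ->
  \int[nu]_y (f y)%:E = \int[mu]_x ((H x)%:E * (f (Y x))%:E).
Proof.
move=> mf f0.
have mEf : measurable_fun setT (EFin \o f) by exact/measurable_EFinP.
pose f_ := nnsfun_approx measurableT mEf.
have f_0 n y : (0 <= f_ n y)%R by [].
have nd y m n : (m <= n)%N -> (f_ m y <= f_ n y)%R.
  by move=> mn; exact/lefP/nd_nnsfun_approx.
have cvgf y : (f_ n y)%:E @[n --> \oo] --> (f y)%:E.
  by apply: cvg_nnsfun_approx => // z _; rewrite lee_fin.
have mHf (g : {nnsfun T' >-> R}) :
    measurable_fun setT (fun x => (H x)%:E * (g (Y x))%:E).
  apply: emeasurable_funM; apply/measurable_EFinP => //.
  exact: measurableT_comp.
transitivity (limn (fun n => \int[nu]_y (f_ n y)%:E)).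
  rewrite -monotone_convergence //.
  - by apply: eq_integral => y _; apply/esym/cvg_lim => //; exact: cvgf.
  - by move=> n; exact/measurable_EFinP.
  - by move=> n y _; rewrite lee_fin.
  - by move=> y _ m n mn; rewrite lee_fin nd.
transitivity (limn (fun n => \int[mu]_x ((H x)%:E * (f_ n (Y x))%:E)));
  last first.
  rewrite -monotone_convergence //.
  - apply: eq_integral => x _; apply/cvg_lim => //.
    apply: cvgeM; [ | exact: cvg_cst|exact: cvgf].
    exact: mule_def_fin.
  - by move=> n x _; rewrite mule_ge0 ?lee_fin //.
  - by move=> x _ m n mn; rewrite lee_wpmul2l ?lee_fin // nd.
apply/congr_lim/funext => n /=.
have mfib k : measurable (Y @^-1` (f_ n @^-1` [set k])).
  exact: measurable_preimY.
under [LHS]eq_integral do rewrite fimfunE -fsumEFin//.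
rewrite ge0_integral_fsum//; last 2 first.
- by move=> r; exact/measurable_EFinP/measurable_funM.
- by move=> r y _; rewrite nnfun_muleindic_ge0.
transitivity (\sum_(k \in range (f_ n))
    \int[mu]_x ((H x)%:E * (k * \1_(f_ n @^-1` [set k]) (Y x))%:E)).
  apply: eq_fsbigr => r /[!inE] -[y _ <-].
  rewrite integralZl_indic_nnsfun// integral_indic//= setIT.
  under eq_integral do rewrite EFinM muleCA.
  rewrite ge0_integralZl_EFin //.
  - rewrite /weighted_law [in LHS]integral_mkcond; congr (_ * _).
    by apply: eq_integral => x _; rewrite epatch_indic.
  - by move=> x _; rewrite mule_ge0 ?lee_fin //.
  - apply: emeasurable_funM; apply/measurable_EFinP => //.
    exact: measurableT_comp.
rewrite -ge0_integral_fsum//.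
- apply: eq_integral => x _.
  rewrite [in RHS]fimfunE -fsumEFin// ge0_mule_fsumr //.
  by move=> r; rewrite nnfun_muleindic_ge0.
- move=> r; apply: emeasurable_funM; apply/measurable_EFinP => //.
  by apply: measurable_funM => //; exact: measurableT_comp.
- move=> r x _; apply: mule_ge0; first by rewrite lee_fin.
  by rewrite EFinM nnfun_muleindic_ge0.
Qed.

End WeightedLaw.


(** * Products of functions of disjoint pairs of independent variables *)

Section IndependentPairs.
Local Open Scope ereal_scope.
Context d d' (Omega : measurableType d) (S : measurableType d') (R : realType).
Variables (P : probability Omega R) (I : finType) (X : I -> {RV P >-> S}).
Hypothesis indepX : mutually_independent X.

Definition cylinder (J : {set I}) (A : I -> set S) : set Omega :=
  \bigcap_(i in [set` J]) X i @^-1` A i.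

Implicit Types (J K : {set I}) (A : I -> set S).

Lemma measurable_cylinder J A :
  (forall i, i \in J -> measurable (A i)) -> measurable (cylinder J A).
Proof.
move=> mA; apply: fin_bigcap_measurable => // i Ji.
by rewrite -[_ @^-1` _]setTI; exact/measurable_funP/mA.
Qed.

Lemma cylinderI J K A B : [disjoint J & K]%bool ->
  cylinder J A `&` cylinder K B =
  cylinder (J :|: K)%SET (fun i => if i \in J then A i else B i).
Proof.
move=> JK; apply/seteqP; split=> w.
  move=> [wJ wK] i /=; rewrite inE; case: ifP => [/wJ //|_ /=]; exact: wK.
move=> wJK; split=> i /= iJ.
  by have := wJK i; rewrite /= inE iJ; apply.
by have := wJK i; rewrite /= inE iJ orbT (disjointFl JK iJ); apply.
Qed.

Lemma cylinder0 A : cylinder finset.set0 A = setT.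
Proof. by apply/seteqP; split=> // w _ i /=; rewrite inE. Qed.

Lemma probability_cylinderI J K A B : [disjoint J & K]%bool ->
  (forall i, i \in J -> measurable (A i)) ->
  (forall i, i \in K -> measurable (B i)) ->
  P (cylinder J A `&` cylinder K B) = P (cylinder J A) * P (cylinder K B).
Proof.
move=> JK mA mB; rewrite cylinderI // /cylinder !indepX //; last first.
  by move=> i; rewrite inE; case: ifP => [/mA //|_ /= /mB].
rewrite (eq_bigl [predU J & K]) => [|i]; last by rewrite !inE.
rewrite bigU //=; congr (_ * _); apply: eq_bigr => i iJ; first by rewrite iJ.
by rewrite (disjointFl JK iJ).
Qed.

Variables (E : eqType) (o : E -> I * I) (phi : E -> S * S -> R).

Definition pair_at e : Omega -> S * S := fun w => (X (o e).1 w, X (o e).2 w).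

Lemma measurable_pair_at e : measurable_fun setT (pair_at e).
Proof. by apply: measurable_fun_pair; exact: measurable_funP. Qed.

Lemma pair_at_rectangle e (B1 B2 : set S) : (o e).1 != (o e).2 ->
  pair_at e @^-1` (B1 `*` B2) =
  cylinder [set (o e).1; (o e).2]%SET
    (fun i => if i == (o e).1 then B1 else B2).
Proof.
move=> ne; apply/seteqP; split=> w.
  move=> [/= w1 w2] i /=; rewrite !inE => /orP[] /eqP ->; first by rewrite eqxx.
  by rewrite eq_sym (negbTE ne).
move=> h; split=> /=.
  by have := h (o e).1; rewrite /= !inE eqxx; apply.
by have := h (o e).2; rewrite /= !inE eqxx orbT eq_sym (negbTE ne); apply.
Qed.

Definition vertex_disjoint (s : seq E) : bool :=
  pairwise [rel e f | [disjoint [set (o e).1; (o e).2]%SET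
                              & [set (o f).1; (o f).2]%SET]%bool] s.

(** Induction on [s], with an arbitrary cylinder on the remaining indices
    carried along. To split off the function of a pair [e], compare the law of
    this pair under the density [H * \1_D] ([H] the other factors, [D] the
    cylinder) with its law under the constant density of the same mass. They
    agree on rectangles, since a rectangle condition on the pair merely enlarges
    the cylinder in the induction hypothesis, and rectangles form a pi-system. *)
Lemma integral_prod_pairs (s : seq E) J A :
  (forall e, e \in s -> measurable_fun setT (phi e)) ->
  (forall e x, e \in s -> (0 <= phi e x)%R) ->
  (forall e, e \in s -> \int[P]_w (phi e (pair_at e w))%:E < +oo) ->
  (forall e, e \in s -> (o e).1 != (o e).2) ->
  vertex_disjoint s ->
  (forall e, e \in s -> [disjoint [set (o e).1; (o e).2]%SET & J]%bool) ->
  (forall i, i \in J -> measurable (A i)) ->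
  \int[P]_(w in cylinder J A) (\prod_(e <- s) phi e (pair_at e w))%:E =
  \prod_(e <- s) \int[P]_w (phi e (pair_at e w))%:E * P (cylinder J A).
Proof.
elim: s J A => [|e s IHs] J A mphi phi0 phioo ne dis disJ mA.
  under eq_integral do rewrite big_nil.
  by rewrite big_nil integral_cst ?mul1e //; exact: measurable_cylinder.
have es f : f \in s -> f \in e :: s by move=> fs; rewrite inE fs orbT.
have e_es : e \in e :: s by exact: mem_head.
move: dis => /andP[/allP e_dis s_dis].
have {}IHs K B := IHs K B (fun f fs => mphi f (es f fs))
  (fun f x fs => phi0 f x (es f fs)) (fun f fs => phioo f (es f fs))
  (fun f fs => ne f (es f fs)) s_dis.
pose D := cylinder J A.
have mD : measurable D by exact: measurable_cylinder.
pose H w := (\prod_(f <- s) phi f (pair_at f w))%R.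
have H0 w : (0 <= H w)%R.
  by rewrite /H big_seq; apply: prodr_ge0 => f /es fs; exact: phi0.
have mH : measurable_fun setT H.
  apply: measurable_prod => f /es fs; apply: measurableT_comp (mphi f fs) _.
  exact: measurable_pair_at.
pose p := \prod_(f <- s) \int[P]_w (phi f (pair_at f w))%:E.
have p_fin : p \is a fin_num.
  rewrite /p big_seq; apply: (big_ind (fun x => x \is a fin_num)) => //.
    by move=> x y; exact: fin_numM.
  move=> f /es fs; rewrite ge0_fin_numE ?phioo //.
  by apply: integral_ge0 => w _; rewrite lee_fin phi0.
have HD : \int[P]_(w in D) (H w)%:E = p * P D.
  by apply: IHs => // f /es; exact: disJ.
have [c cE] : exists c : R, p * P D = c%:E.
  by exists (fine (p * P D)); rewrite fineK // fin_numM // fin_num_measure.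
have c0 : (0 <= c)%R.
  by rewrite -lee_fin -cE -HD; apply: integral_ge0 => w _; rewrite lee_fin.
pose H1 w := (H w * \1_D w)%R.
have mH1 : measurable_fun setT H1 by exact: measurable_funM.
have H10 w : (0 <= H1 w)%R by rewrite mulr_ge0.
have mc : measurable_fun setT (cst c : Omega -> R) by [].
have c0' (w : Omega) : (0 <= cst c w)%R by [].
have mY := measurable_pair_at e.
have int_cut (Q : set Omega) : measurable Q ->
    \int[P]_(w in Q) (H1 w)%:E = \int[P]_(w in D `&` Q) (H w)%:E.
  move=> mQ; rewrite [in RHS]setIC [in RHS]integral_mkcondr.
  by apply: eq_integral => w _; rewrite epatch_indic /H1 EFinM.
have laws B : measurable B ->
    weighted_law P mH1 H10 mY B = weighted_law P mc c0' mY B.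
  move=> mB.
  apply: (measure_unique [set B1 `*` B2 | B1 in measurable & B2 in measurable]
    (fun=> setT)) => //.
  - exact: measurable_prod_measurableType.
  - move=> _ _ [B1 mB1 [B2 mB2 <-]] [B1' mB1' [B2' mB2' <-]]; rewrite -setXI.
    exists (B1 `&` B1'); first exact: measurableI.
    by exists (B2 `&` B2') => //; exact: measurableI.
  - by move=> _; exists setT => //; exists setT => //; rewrite setXTT.
  - by rewrite bigcup_const.
  - move=> _ [B1 mB1 [B2 mB2 <-]].
    have ne_e := ne e e_es.
    rewrite /= /weighted_law pair_at_rectangle //.
    set K := [set (o e).1; (o e).2]%SET; set C := fun i => _.
    have mC i : measurable (C i) by rewrite /C; case: ifP.
    have mK : measurable (cylinder K C) by exact: measurable_cylinder.
    have JK : [disjoint J & K]%bool by rewrite disjoint_sym disJ.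
    transitivity (c%:E * P (cylinder K C)); last by rewrite -integral_cst.
    rewrite int_cut // -cE -muleA -probability_cylinderI //.
    rewrite cylinderI // IHs // => [f fs|i].
      rewrite disjoint_subset; apply/fintype.subsetP => i fi.
      rewrite !inE negb_or (disjointFr (disJ f (es f fs)) fi).
      by have := disjointFl (e_dis f fs) fi; rewrite !inE => ->.
    by rewrite inE; case: ifP => [/mA //|].
  - move=> _; rewrite /= /weighted_law preimage_setT int_cut //.
    by rewrite setIT HD cE ltry.
have -> : \int[P]_(w in D) (\prod_(f <- e :: s) phi f (pair_at f w))%:E =
    \int[P]_w ((H1 w)%:E * (phi e (pair_at e w))%:E).
  rewrite integral_mkcond; apply: eq_integral => w _.
  by rewrite epatch_indic /= big_cons -/(H w) -!EFinM -mulrA mulrC.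
rewrite -integral_weighted_law //; [|exact: mphi|by move=> x; exact: phi0].
rewrite (eq_measure_integral (weighted_law P mc c0' mY)); last first.
  by move=> B mB _; exact: laws.
rewrite integral_weighted_law //; [|exact: mphi|by move=> x; exact: phi0].
rewrite ge0_integralZl_EFin //.
- by rewrite /= -cE big_cons muleC muleA.
- by move=> w _; rewrite lee_fin phi0.
- by apply/measurable_EFinP; apply: measurableT_comp; first exact: mphi.
Qed.

End IndependentPairs.

Lemma exponential_moment_disjoint_pairs d d' (Omega : measurableType d)
    (S : measurableType d') (R : realType) (P : probability Omega R)
    (I : finType) (X : I -> {RV P >-> S}) (E : eqType) (o : E -> I * I)
    (g : E -> S * S -> R) (c : E -> R) (s : seq E) :
  mutually_independent X ->
  (forall e, e \in s -> measurable_fun setT (g e)) ->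
  (forall e, e \in s ->
    (\int[P]_w (expR (g e (pair_at X o e w)))%:E <= (expR (c e))%:E)%E) ->
  (forall e, e \in s -> (o e).1 != (o e).2) ->
  vertex_disjoint o s ->
  (\int[P]_w (expR (\sum_(e <- s) g e (pair_at X o e w)))%:E
   <= (expR (\sum_(e <- s) c e))%:E)%E.
Proof.
move=> indepX mg gc ne dis.
under eq_integral do rewrite expR_sum.
rewrite -(cylinder0 X (fun=> setT)).
rewrite (integral_prod_pairs indepX (o := o)
  (phi := fun e x => expR (g e x))) //.
- rewrite cylinder0 probability_setT mule1 expR_sum -prodEFin.
  rewrite big_seq [leRHS]big_seq.
  suff /andP[] : (0 <= \prod_(e <- s | e \in s)
        \int[P]_w (expR (g e (pair_at X o e w)))%:E
      <= \prod_(e <- s | e \in s) (expR (c e))%:E)%E by [].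
  apply: (big_ind2 (fun x y => 0 <= x <= y)%E).
  - by rewrite lexx lee01.
  - move=> x y x' y' /andP[x0 xy] /andP[x'0 xy'].
    by rewrite mule_ge0 //= lee_pmul.
  - move=> e es; rewrite gc // andbT.
    by apply: integral_ge0 => w _; rewrite lee_fin expR_ge0.
- by move=> e es; apply: measurableT_comp => //; exact: mg.
- by move=> e es; rewrite (le_lt_trans (gc e es)) // ltry.
- by move=> e _; rewrite -setI_eq0 finset.setI0.
Qed.


(** * Sums and tails of sub-Gaussian variables *)

(** Average the tangent line inequality at the barycentre [m]. *)
Lemma expR_jensen (R : realType) (K : finType) (p a : K -> R) :
  (forall k, 0 <= p k) -> \sum_k p k = 1 ->
  expR (\sum_k p k * a k) <= \sum_k p k * expR (a k).
Proof.
move=> p0 p1; set m := \sum_k _ * a k.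
have -> : expR m = \sum_k p k * (expR m * (1 + (a k - m))).
  transitivity (expR m * (\sum_k p k + (m - m * \sum_k p k))).
    by rewrite p1 mulr1 subrr addr0 mulr1.
  rewrite {2}/m mulr_sumr -sumrB -big_split mulr_sumr.
  by apply: eq_bigr => k _ /=; ring.
apply: ler_sum => k _; apply: ler_wpM2l => //.
rewrite -[a k in leRHS](subrKC m) expRD.
by apply: ler_wpM2l; [exact: expR_ge0|exact: expR_ge1Dx].
Qed.

(** Expand the nonnegative sum of the [(#|K| * a k - s) ^+ 2], where [s] is the
    sum of the [a k]. *)
Lemma sqr_sum_le (R : realType) (K : finType) (a : K -> R) :
  (\sum_k a k) ^+ 2 <= #|K|%:R * \sum_k a k ^+ 2.
Proof.
set s := \sum_k a k; set q := \sum_k _ ^+ 2.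
have [K0|K0] := posnP #|K|.
  rewrite /s big1 ?expr0n ?K0 ?mul0r // => k _.
  by have := fintype0 k; rewrite K0 => /(_ erefl).
have n0 : 0 < #|K|%:R :> R by rewrite ltr0n.
have : 0 <= \sum_k (#|K|%:R * a k - s) ^+ 2.
  by apply: sumr_ge0 => k _; exact: sqr_ge0.
have -> : \sum_k (#|K|%:R * a k - s) ^+ 2 = #|K|%:R * (#|K|%:R * q - s ^+ 2).
  transitivity
    (\sum_k (#|K|%:R ^+ 2 * a k ^+ 2 - 2 * #|K|%:R * s * a k + s ^+ 2)).
    by apply: eq_bigr => k _; ring.
  rewrite big_split sumrB -!mulr_sumr -/s -/q sumr_const -mulr_natl /=; ring.
by rewrite pmulr_rge0 // subr_ge0.
Qed.

Section SubGaussian.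
Context d (Omega : measurableType d) (R : realType) (P : probability Omega R).

Lemma measurable_expR_scale (c : R) (S : Omega -> R) : measurable_fun setT S ->
  measurable_fun setT (fun w => expR (c * S w)).
Proof.
by move=> mS; apply: measurableT_comp => //; exact: measurable_funM.
Qed.

(** Jensen's inequality with weights [p k] proportional to [sqrt (v k)] makes
    all the bounds [(lambda / p k) ^+ 2 * v k / 2] equal. When [v k = 0] the
    weight vanishes, and [S k] has to be zero, as for an empty sum. *)
Lemma subgaussian_sum (K : finType) (S : K -> Omega -> R) (v : K -> R) :
  (forall k, measurable_fun setT (S k)) ->
  (forall k, 0 <= v k) -> (forall k, v k = 0 -> forall w, S k w = 0) ->
  (forall k mu, 0 < mu ->
     (\int[P]_w (expR (mu * S k w))%:E <= (expR (mu ^+ 2 * v k / 2))%:E)%E) ->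
  forall lambda, 0 < lambda ->
    (\int[P]_w (expR (lambda * \sum_k S k w))%:E
     <= (expR (lambda ^+ 2 * (\sum_k Num.sqrt (v k)) ^+ 2 / 2))%:E)%E.
Proof.
move=> mS v0 S0 subS lambda lambda0.
set s := \sum_k Num.sqrt (v k).
have sq0 k : 0 <= Num.sqrt (v k) := sqrtr_ge0 _.
have [s0|s_neq0] := eqVneq s 0.
  have Sz w k : S k w = 0.
    apply: S0; have /eqP := s0; rewrite psumr_eq0 => [/allP/(_ k)|//].
    rewrite mem_index_enum sqrtr_eq0 => /(_ isT) /implyP/(_ isT) vk.
    by apply/eqP; rewrite eq_le vk v0.
  under eq_integral do rewrite big1 // mulr0 expR0.
  rewrite s0 expr0n mulr0 mul0r expR0 integral_cst // mul1e.
  exact: probability_le1.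
have s_gt0 : 0 < s by rewrite lt_neqAle eq_sym s_neq0 sumr_ge0.
pose p k := Num.sqrt (v k) / s.
have p0 k : 0 <= p k by rewrite divr_ge0 // ltW.
have p1 : \sum_k p k = 1 by rewrite -mulr_suml divff.
have mexp k : measurable_fun setT
    (fun w => (p k)%:E * (expR (lambda / p k * S k w))%:E)%E.
  apply: emeasurable_funM => //; apply/measurable_EFinP.
  exact: measurable_expR_scale.
apply: (@le_trans _ _
  (\int[P]_w \sum_k ((p k)%:E * (expR (lambda / p k * S k w))%:E))%E).
  apply: ge0_le_integral => //.
  - apply/measurable_EFinP; apply: measurable_expR_scale; exact: measurable_sum.
  - by apply: emeasurable_sum.
  - move=> w _; under [leRHS]eq_bigr do rewrite -EFinM; rewrite sumEFin lee_fin.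
    apply: le_trans (expR_jensen _ p0 p1); rewrite ler_expR mulr_sumr.
    apply: ler_sum => k _.
    have [vk|vk] := eqVneq (v k) 0; first by rewrite (S0 k vk) !mulr0.
    have pk : p k != 0.
      rewrite mulf_neq0 ?invr_neq0 // sqrtr_eq0 -ltNge.
      by rewrite lt_neqAle eq_sym vk v0.
    by rewrite mulrA mulrCA divff // mulr1.
rewrite ge0_integral_sum //; last first.
  by move=> k w _; rewrite -EFinM lee_fin mulr_ge0 ?expR_ge0.
apply: (@le_trans _ _
  (\sum_k (p k)%:E * (expR (lambda ^+ 2 * s ^+ 2 / 2))%:E)%E); last first.
  by under eq_bigr do rewrite -EFinM; rewrite sumEFin -mulr_suml p1 mul1r.
apply: lee_sum => k _; rewrite ge0_integralZl_EFin //; last first.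
  by apply/measurable_EFinP; exact: measurable_expR_scale.
have [pk|pk] := eqVneq (p k) 0; first by rewrite pk !mul0e.
have vk : v k != 0 by apply: contra_neq pk => vk; rewrite /p vk sqrtr0 mul0r.
apply: lee_wpmul2l; first by rewrite lee_fin.
apply: le_trans (subS k _ _) _.
  by rewrite divr_gt0 // lt_neqAle eq_sym pk p0.
rewrite lee_fin ler_expR le_eqVlt; apply/orP; left; apply/eqP.
rewrite -(sqr_sqrtr (v0 k)) /p; field.
by rewrite s_neq0 sqrtr_eq0 -ltNge lt_neqAle eq_sym vk v0.
Qed.

(** Chernoff's bound; [lambda = a / V] minimizes
    [lambda ^+ 2 * V / 2 - lambda * a]. *)
Lemma subgaussian_tail (S : Omega -> R) (V a : R) :
  measurable_fun setT S -> 0 < V -> 0 < a ->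
  (forall lambda, 0 < lambda ->
    (\int[P]_w (expR (lambda * S w))%:E
     <= (expR (lambda ^+ 2 * V / 2))%:E)%E) ->
  (P [set w | (S w > a)%R] <= (expR (- (a ^+ 2 / (2 * V))))%:E)%E.
Proof.
move=> mS V0 a0 subS.
have mA : measurable [set w | (S w > a)%R].
  rewrite (_ : [set w | _] = setT `&` S @^-1` `]a, +oo[%classic).
    exact: mS.
  by rewrite setTI; apply/seteqP; split=> w /=; rewrite in_itv /= andbT.
pose l := a / V; have l0 : 0 < l by rewrite divr_gt0.
have mE : measurable_fun setT (fun w => expR (l * S w)).
  exact: measurable_expR_scale.
have mark : ((expR (l * a))%:E * P [set w | (S w > a)%R]
    <= \int[P]_w (expR (l * S w))%:E)%E.
  rewrite -integral_cst //.
  apply: (@le_trans _ _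
    (\int[P]_(w in [set w | (S w > a)%R]) (expR (l * S w))%:E)%E).
    apply: ge0_le_integral => //.
    - by move=> w _; rewrite lee_fin expR_ge0.
    - by apply/measurable_EFinP; exact: measurable_funTS.
    - by move=> w /= aw; rewrite lee_fin ler_expR ler_pM2l // ltW.
  by apply: ge0_subset_integral => //; exact/measurable_EFinP.
rewrite -[leLHS]mul1e.
rewrite (_ : 1%E = (expR (- (l * a)) * expR (l * a))%:E); last first.
  by rewrite mulrC expRxMexpNx_1.
rewrite EFinM -muleA.
apply: (@le_trans _ _ ((expR (- (l * a)))%:E * (expR (l ^+ 2 * V / 2))%:E)%E).
  apply: lee_wpmul2l; first by rewrite lee_fin expR_ge0.
  exact: le_trans mark (subS l l0).
rewrite -EFinM -expRD lee_fin ler_expR le_eqVlt; apply/orP; left; apply/eqP.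
by rewrite /l; field; rewrite gt_eqF.
Qed.

End SubGaussian.

(** * The concentration inequality *)

Theorem corollary2 (R : realType) (d : measure_display)
    (Omega : measurableType d) (P : probability Omega R) (n p : nat)
    (X : 'I_n -> {RV P >-> euclidean R p})
    (indepX : mutually_independent X)
    (G : sgraph 'I_n) (edges_gt0 : (0 < #|edges G|)%N)
    (o : {set 'I_n} -> 'I_n * 'I_n) (orderG : endpoint_order G o)
    (h : {set 'I_n} -> euclidean R p * euclidean R p -> R)
    (measurable_h : forall e, e \in edges G -> measurable_fun setT (h e))
    (integrable_h : forall e, e \in edges G ->
      P.-integrable setT (EFin \o kernel_at X o h e))
    (sigma : {set 'I_n} -> R)
    (sigma_gt0 : forall e, e \in edges G -> 0 < sigma e)
    (subgaussian_h : forall e, e \in edges G ->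
      forall lambda : R, 0 < lambda ->
      ('E_P[(fun w => expR (lambda *
               (kernel_at X o h e w - fine 'E_P[kernel_at X o h e])))]
       <= (expR (lambda ^+ 2 * sigma e ^+ 2 / 2))%:E)%E) :
  let N : R := #|edges G|%:R in
  let U : Omega -> R := graph_sum X G o h in
  let sigma2 : R := N^-1 * \sum_(e in edges G) sigma e ^+ 2 in
  forall t : R, 0 < t ->
  (P [set w | ((U w - fine 'E_P[U]) / N > t)%R]
   <= (expR (- (N * t ^+ 2 / (2 * ((max_degree G)%:R + 1) * sigma2))))%:E)%E.
Proof.
move=> N U sigma2 t t0.
have [chi chiP] := vizing G.
pose k_at := kernel_at X o h.
have expectE (F : Omega -> R) : ('E_P[F] = \int[P]_w (F w)%:E)%E.
  by rewrite unlock.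
pose m e := fine 'E_P[k_at e].
pose S k w := \sum_(e in edges G | chi e == k) (k_at e w - m e).
pose v k := \sum_(e in edges G | chi e == k) sigma e ^+ 2.
have m_k e : e \in edges G -> measurable_fun setT (k_at e).
  move=> eG; apply: measurableT_comp (measurable_h e eG) _.
  exact: (measurable_pair_at X o e).
have EU : fine 'E_P[U] = \sum_(e in edges G) m e.
  pose f e w := if e \in edges G then (k_at e w)%:E else 0%E.
  have intf e : P.-integrable setT (f e).
    have [eG|eN] := boolP (e \in edges G); last first.
      by rewrite /f (negbTE eN); exact: integrable0.
    by rewrite /f eG; exact: integrable_h.
  have finE e : e \in edges G -> (\int[P]_w (k_at e w)%:E = (m e)%:E)%E.
    move=> eG; rewrite /m unlock fineK //; apply: integrable_fin_num => //.
    exact: integrable_h.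
  suff UEm : (\int[P]_w (U w)%:E = (\sum_(e in edges G) m e)%:E)%E.
    by rewrite expectE UEm.
  rewrite -sumEFin; under [RHS]eq_bigr => e eG do rewrite -(finE e eG).
  transitivity (\int[P]_w (\sum_(e in edges G) f e w))%E.
    apply: eq_integral => w _; rewrite /U /graph_sum -sumEFin.
    by apply: eq_bigr => e eG; rewrite /f eG.
  rewrite integral_sum //; apply: eq_bigr => e eG.
  by rewrite /f eG.
have UE w : U w - fine 'E_P[U] = \sum_k S k w.
  by rewrite EU /U /graph_sum -sumrB (partition_big chi xpredT).
pose D := (max_degree G).+1.
have V_eq : \sum_k v k = \sum_(e in edges G) sigma e ^+ 2.
  by rewrite [RHS](partition_big chi xpredT).
set V := \sum_(e in edges G) _ in V_eq.
have V0 : 0 < V.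
  have /card_gt0P[e eG] := edges_gt0.
  rewrite /V (bigD1 e) //= ltr_pwDl ?exprn_gt0 ?sigma_gt0 //.
  by apply: sumr_ge0 => f _; exact: sqr_ge0.
have mS k : measurable_fun setT (S k).
  rewrite /S; under eq_fun do rewrite big_mkcond.
  apply: measurable_sum => e.
  case: (boolP ((e \in edges G) && (chi e == k))) => [/andP[eG _]|_] /=;
    last exact: measurable_cst.
  by apply: measurable_funB => //; exact: m_k.
have v0 k : 0 <= v k by apply: sumr_ge0 => e _; exact: sqr_ge0.
have vS k : v k = 0 -> forall w, S k w = 0.
  move=> /eqP; rewrite psumr_eq0 => [/allP vk w|e _]; last exact: sqr_ge0.
  apply: big1 => e ek; have := vk e (mem_index_enum _).
  by rewrite ek /= sqrf_eq0 gt_eqF // sigma_gt0 //; case/andP: ek.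
have ne e : e \in edges G -> (o e).1 != (o e).2.
  move=> eG; have := cards2 (o e).1 (o e).2.
  by rewrite -(orderG e eG) (card_edge eG); case: (_ != _).
have subS k mu : 0 < mu ->
    (\int[P]_w (expR (mu * S k w))%:E <= (expR (mu ^+ 2 * v k / 2))%:E)%E.
  move=> mu0.
  pose s := enum [pred e | (e \in edges G) && (chi e == k)].
  have sG e : e \in s -> e \in edges G by rewrite mem_enum inE => /andP[].
  have schi e : e \in s -> chi e = k by rewrite mem_enum inE => /andP[_ /eqP].
  have S_seq w : mu * S k w = \sum_(e <- s) mu * (k_at e w - m e).
    by rewrite /S mulr_sumr /s big_enum.
  have v_seq : mu ^+ 2 * v k / 2 = \sum_(e <- s) mu ^+ 2 * sigma e ^+ 2 / 2.
    by rewrite /v mulr_sumr mulr_suml /s big_enum.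
  under eq_integral do rewrite S_seq.
  rewrite v_seq.
  apply: (exponential_moment_disjoint_pairs (o := o)
    (g := fun e x => mu * (h e x - m e)) indepX).
  - move=> e /sG eG; apply: measurable_funM => //; apply: measurable_funB => //.
    exact: measurable_h.
  - move=> e /sG eG; apply: le_trans (subgaussian_h e eG mu mu0).
    by rewrite [leRHS]expectE.
  - by move=> e /sG; exact: ne.
  - rewrite /vertex_disjoint; apply/(pairwiseP finset.set0) => i j iS jS ij /=.
    set e := nth _ _ i; set f := nth _ _ j.
    have es : e \in s by exact: mem_nth.
    have fs : f \in s by exact: mem_nth.
    have ef : e != f by rewrite nth_uniq ?enum_uniq // ltn_eqF.
    rewrite -(orderG e (sG e es)) -(orderG f (sG f fs)) disjoint_subset.
    apply/fintype.subsetP => u ue; apply/negP => uf; case/eqP: ef.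
    by apply: (chiP e f u) => //; rewrite ?sG ?schi.
pose V' := D%:R * V.
have N0 : 0 < N by rewrite ltr0n.
have -> : [set w | ((U w - fine 'E_P[U]) / N > t)%R] =
    [set w | (\sum_k S k w > t * N)%R].
  by apply/seteqP; split=> w /=; rewrite UE ltr_pdivlMr.
apply: le_trans (subgaussian_tail (V := V') _ _ _ _) _.
- exact: measurable_sum.
- by rewrite mulr_gt0 // ltr0n.
- exact: mulr_gt0.
- move=> lambda lambda0.
  apply: le_trans (subgaussian_sum mS v0 vS subS lambda0) _.
  rewrite lee_fin ler_expR ler_pM2r // ler_wpM2l ?sqr_ge0 //.
  apply: le_trans (sqr_sum_le _) _; rewrite card_ord ler_wpM2l //.
  by rewrite -V_eq; apply: ler_sum => k _; rewrite sqr_sqrtr.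
- rewrite lee_fin ler_expR le_eqVlt; apply/orP; left; apply/eqP.
  rewrite /sigma2 -/V /V' /D -natr1; field.
  by rewrite !gt_eqF // natr1 ltr0n.
Qed.
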